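(* Let $a,b\in\mathbb{R}^4$, $\alpha\in\mathbb{R}\setminus\{0\}$, $A\in O(4)$, $\varepsilon\in\{0,2\}$, and consider the Möbius transformation $$\phi(x)=a+\frac{\alpha A(x-b)}{|x-b|^{\varepsilon}},$$ defined on $\mathbb{R}^4$ if $\varepsilon=0$ and on $\mathbb{R}^4\setminus\{b\}$ if $\varepsilon=2$. Endow both the domain and the codomain $\mathbb{R}^4$ with the spherical metric $g_S=\frac{4\,dx^2}{(1+|x|^2)^2}$. Then $\phi$ is biharmonic if and only if it is an isometry (i.e. $\phi^*g_S=g_S$), and in that case $\phi$ is also harmonic. Consequently, no Möbius transformation of this form is proper biharmonic with respect to these metrics.
   Context: For a smooth map $\phi:(M,g)\to(N,h)$ between Riemannian manifolds, the tension field is $\tau(\phi)=\mathrm{Tr}_g\nabla d\phi$; $\phi$ is harmonic if $\tau(\phi)\equiv0$. The map $\phi$ is biharmonic if $$-\mathrm{Tr}_g(\nabla^\phi)^2\tau(\phi)-\mathrm{Tr}_g R^N(\tau(\phi),d\phi)d\phi=0,$$ where $\nabla^\phi$ is the pull-back connection on $\phi^{-1}TN$ and $R^N$ is the Riemannian curvature of $N$ with the convention $R(X,Y)Z=\nabla_X\nabla_YZ-\nabla_Y\nabla_XZ-\nabla_{[X,Y]}Z$. A map is proper biharmonic if it is biharmonic but not harmonic. *)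

(* Defs.v *)
From HB Require Import structures.
From mathcomp Require Import all_boot all_order all_algebra.
From mathcomp Require Import all_classical all_reals all_analysis.

Set Implicit Arguments.
Unset Strict Implicit.
Unset Printing Implicit Defensive.

Import Order.TTheory GRing.Theory Num.Theory.
Import numFieldNormedType.Exports.

Local Open Scope classical_set_scope.
Local Open Scope ring_scope.

(* Riemannian geometry of open subsets of R^n, in the global coordinates of
   'cV[R]_n.  All tangent spaces are identified with 'cV[R]_n, so a vector
   field, or a vector field along a map, is a function between column spaces,
   and a constant function is a field with constant coordinates.  Points
   outside the open set under consideration carry irrelevant values. *)
Section RiemannianCoordinates.
Variable R : realType.

Definition basis_vec n (i : 'I_n.+1) : 'cV[R]_n.+1 := delta_mx i 0.

(* C^oo on the open set U: all iterated directional derivatives exist and are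
   Frechet differentiable at every point of U. *)
Definition smooth_on m n (U : set 'cV[R]_m.+1)
    (f : 'cV[R]_m.+1 -> 'cV[R]_n.+1) : Prop :=
  forall (s : seq 'cV[R]_m.+1) (x : 'cV[R]_m.+1), U x ->
    differentiable (foldr (fun v g => 'D_v g) f s) x.

(* The Gram matrix of the metric in the coordinate frame. *)
Definition metric n := 'cV[R]_n -> 'M[R]_n.

Definition inner n (g : metric n) (x u v : 'cV[R]_n) : R :=
  (u^T *m g x *m v) 0 0.

Definition trace_metric m n (g : metric m.+1) (x : 'cV[R]_m.+1)
    (B : 'cV[R]_m.+1 -> 'cV[R]_m.+1 -> 'cV[R]_n.+1) : 'cV[R]_n.+1 :=
  \sum_(i < m.+1) \sum_(j < m.+1)
    invmx (g x) i j *: B (basis_vec i) (basis_vec j).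

(* Gamma^k_ij of the Levi-Civita connection. *)
Definition christoffel n (g : metric n.+1) (x : 'cV[R]_n.+1)
    (k i j : 'I_n.+1) : R :=
  2^-1 * \sum_(l < n.+1) invmx (g x) k l *
    ('D_(basis_vec i) (fun y => g y j l) x
     + 'D_(basis_vec j) (fun y => g y i l) x
     - 'D_(basis_vec l) (fun y => g y i j) x).

Definition christoffel_vec n (g : metric n.+1) (x u v : 'cV[R]_n.+1) :
    'cV[R]_n.+1 :=
  \col_k \sum_(i < n.+1) \sum_(j < n.+1)
    christoffel g x k i j * u i 0 * v j 0.

(* The Levi-Civita covariant derivative of the vector field Y along X. *)
Definition nabla n (g : metric n.+1) (X Y : 'cV[R]_n.+1 -> 'cV[R]_n.+1)
    (x : 'cV[R]_n.+1) : 'cV[R]_n.+1 :=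
  'D_(X x) Y x + christoffel_vec g x (X x) (Y x).

Definition lie_bracket n (X Y : 'cV[R]_n.+1 -> 'cV[R]_n.+1)
    (x : 'cV[R]_n.+1) : 'cV[R]_n.+1 :=
  'D_(X x) Y x - 'D_(Y x) X x.

Definition curvature n (g : metric n.+1) (X Y Z : 'cV[R]_n.+1 -> 'cV[R]_n.+1)
    (x : 'cV[R]_n.+1) : 'cV[R]_n.+1 :=
  nabla g X (nabla g Y Z) x - nabla g Y (nabla g X Z) x
  - nabla g (lie_bracket X Y) Z x.

(* The curvature is tensorial, so its value on the tangent vectors u, v, w at
   x is obtained from any extensions; here, the constant ones. *)
Definition curvature_at n (g : metric n.+1) (x u v w : 'cV[R]_n.+1) :
    'cV[R]_n.+1 :=
  curvature g (fun=> u) (fun=> v) (fun=> w) x.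

(* The pull-back connection of f on fields W along f:
   nabla^f_X W = X(W) + Gamma_f(df(X), W). *)
Definition nabla_pullback m n (h : metric n.+1) (f : 'cV[R]_m.+1 -> 'cV[R]_n.+1)
    (X : 'cV[R]_m.+1 -> 'cV[R]_m.+1) (W : 'cV[R]_m.+1 -> 'cV[R]_n.+1)
    (x : 'cV[R]_m.+1) : 'cV[R]_n.+1 :=
  'D_(X x) W x + christoffel_vec h (f x) ('D_(X x) f x) (W x).

(* (nabla df)(u, v) = nabla^f_u (df(v)) - df(nabla_u v). *)
Definition second_fundamental_form m n (g : metric m.+1) (h : metric n.+1)
    (f : 'cV[R]_m.+1 -> 'cV[R]_n.+1) (x u v : 'cV[R]_m.+1) : 'cV[R]_n.+1 :=
  nabla_pullback h f (fun=> u) ('D_v f) x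
  - 'D_(nabla g (fun=> u) (fun=> v) x) f x.

Definition tension m n (g : metric m.+1) (h : metric n.+1)
    (f : 'cV[R]_m.+1 -> 'cV[R]_n.+1) (x : 'cV[R]_m.+1) : 'cV[R]_n.+1 :=
  trace_metric g x (second_fundamental_form g h f x).

(* (nabla^f)^2_(u, v) W = nabla^f_u nabla^f_v W - nabla^f_(nabla_u v) W. *)
Definition nabla_pullback2 m n (g : metric m.+1) (h : metric n.+1)
    (f W : 'cV[R]_m.+1 -> 'cV[R]_n.+1) (x u v : 'cV[R]_m.+1) : 'cV[R]_n.+1 :=
  nabla_pullback h f (fun=> u) (nabla_pullback h f (fun=> v) W) x
  - nabla_pullback h f (nabla g (fun=> u) (fun=> v)) W x.

Definition bitension m n (g : metric m.+1) (h : metric n.+1)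
    (f : 'cV[R]_m.+1 -> 'cV[R]_n.+1) (x : 'cV[R]_m.+1) : 'cV[R]_n.+1 :=
  - trace_metric g x (nabla_pullback2 g h f (tension g h f) x)
  - trace_metric g x (fun u v =>
      curvature_at h (f x) (tension g h f x) ('D_u f x) ('D_v f x)).

Definition harmonic_on m n (U : set 'cV[R]_m.+1) (g : metric m.+1) (h : metric n.+1)
    (f : 'cV[R]_m.+1 -> 'cV[R]_n.+1) : Prop :=
  smooth_on U f /\ forall x, U x -> tension g h f x = 0.

Definition biharmonic_on m n (U : set 'cV[R]_m.+1) (g : metric m.+1)
    (h : metric n.+1) (f : 'cV[R]_m.+1 -> 'cV[R]_n.+1) : Prop :=
  smooth_on U f /\ forall x, U x -> bitension g h f x = 0.

Definition proper_biharmonic_on m n (U : set 'cV[R]_m.+1) (g : metric m.+1)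
    (h : metric n.+1) (f : 'cV[R]_m.+1 -> 'cV[R]_n.+1) : Prop :=
  biharmonic_on U g h f /\ ~ harmonic_on U g h f.

(* f^* h = g on U. *)
Definition isometry_on m n (U : set 'cV[R]_m.+1) (g : metric m.+1)
    (h : metric n.+1) (f : 'cV[R]_m.+1 -> 'cV[R]_n.+1) : Prop :=
  forall x, U x -> forall u v,
    inner h (f x) ('D_u f x) ('D_v f x) = inner g x u v.

(* The library norm on 'cV[R]_n is the sup norm, hence this definition. *)
Definition enorm n (x : 'cV[R]_n) : R := Num.sqrt (\sum_(i < n) x i 0 ^+ 2).

Definition spherical_metric n : metric n :=
  fun x => (4 / (1 + enorm x ^+ 2) ^+ 2)%:M.

Definition orthogonal_mx n (A : 'M[R]_n) : Prop := A^T *m A = 1%:M.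

Definition mobius n (a b : 'cV[R]_n) (alpha : R) (A : 'M[R]_n) (eps : nat)
    (x : 'cV[R]_n) : 'cV[R]_n :=
  a + (alpha / enorm (x - b) ^+ eps) *: (A *m (x - b)).

Definition mobius_domain n (b : 'cV[R]_n) (eps : nat) : set 'cV[R]_n :=
  if eps == 0%N then setT else ~` [set b].

End RiemannianCoordinates.

Arguments spherical_metric {R n} x.

(* Main.v *)
(* Write phi^* g_S = 4 alpha^2 / Q^2 dx^2 with Q(x) = c |x|^2 + 2 q.x + d and
   c d - |q|^2 = alpha^2, while g_S = 4 / S^2 dx^2 with S(x) = 1 + |x|^2.  The
   differential of phi carries the Levi-Civita connection of phi^* g_S to the
   pull-back connection, so tension and bitension become dphi of fields built
   from S and Q only.  With r = grad log (Q / S) one finds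
     tau = dphi W,                 W = (S^2 / 2) r,
     nabla_v W = m v - (S^2 / 2) (r.v) r,
     m = 2 alpha^2 S^2 / Q^2 - (c + d) S / Q,
     Tr nabla^2 W = (2 - 3 alpha^2 S^2 / Q^2) W,
     Tr R(tau, dphi) dphi = (3 alpha^2 S^2 / Q^2) tau,
   hence the bitension of phi is - 2 tau.  So phi is biharmonic iff it is
   harmonic, iff r = 0, iff Q is a multiple of S; the relation
   c d - |q|^2 = alpha^2 then forces Q = +- alpha S, i.e. phi is an isometry. *)
Require Import Defs.
From HB Require Import structures.
From mathcomp Require Import all_boot all_order all_algebra.
From mathcomp Require Import all_classical all_reals all_analysis.
From mathcomp Require Import ring.

Set Implicit Arguments.
Unset Strict Implicit.
Unset Printing Implicit Defensive.

Import Order.TTheory GRing.Theory Num.Theory.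
Import numFieldNormedType.Exports.

Local Open Scope classical_set_scope.
Local Open Scope ring_scope.

(** * Euclidean scalar product on column vectors *)

Section EuclideanDot.
Context {R : realType} {n : nat}.
Implicit Types (k : R) (u v w : 'cV[R]_n).

Definition dot u v : R := \sum_(i < n) u i 0 * v i 0.

Lemma dotC u v : dot u v = dot v u.
Proof. by apply: eq_bigr => i _; rewrite mulrC. Qed.

Lemma dotDl u v w : dot (u + v) w = dot u w + dot v w.
Proof. by rewrite -big_split; apply: eq_bigr => i _; rewrite mxE mulrDl. Qed.

Lemma dotDr u v w : dot w (u + v) = dot w u + dot w v.
Proof. by rewrite dotC dotDl !(dotC w). Qed.

Lemma dotZl k u w : dot (k *: u) w = k * dot u w.
Proof. by rewrite mulr_sumr; apply: eq_bigr => i _; rewrite mxE mulrA. Qed.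

Lemma dotZr k u w : dot w (k *: u) = k * dot w u.
Proof. by rewrite dotC dotZl (dotC w). Qed.

Lemma dotNl u w : dot (- u) w = - dot u w.
Proof. by rewrite -scaleN1r dotZl mulN1r. Qed.

Lemma dotNr u w : dot w (- u) = - dot w u.
Proof. by rewrite dotC dotNl (dotC w). Qed.

Lemma dot0l w : dot 0 w = 0.
Proof. by rewrite -(scale0r 0) dotZl mul0r. Qed.

Lemma dot0r w : dot w 0 = 0.
Proof. by rewrite dotC dot0l. Qed.

Lemma dot_sumr (I : finType) (F : I -> 'cV[R]_n) w :
  dot w (\sum_i F i) = \sum_i dot w (F i).
Proof.
by apply: (big_morph (dot w)) => [u v|]; [exact: dotDr|exact: dot0r].
Qed.

Definition dotE :=
  (dotDl, dotDr, dotZl, dotZr, dotNl, dotNr, dot0l, dot0r).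

Lemma dot_mulmxE u v : dot u v = (u^T *m v) 0 0.
Proof. by rewrite mxE; apply: eq_bigr => i _; rewrite mxE. Qed.

Lemma dot_adj (M : 'M[R]_n) u v : dot (M *m u) v = dot u (M^T *m v).
Proof. by rewrite !dot_mulmxE trmx_mul mulmxA. Qed.

Lemma dot_ge0 u : 0 <= dot u u.
Proof. by apply: sumr_ge0 => i _; rewrite -expr2 sqr_ge0. Qed.

Lemma dot_eq0 u : (dot u u == 0) = (u == 0).
Proof.
apply/eqP/eqP => [u0|->]; last by rewrite dot0l.
apply/colP => i; rewrite mxE; apply/eqP; rewrite -sqrf_eq0 expr2.
move/eqP: u0; rewrite psumr_eq0 => [/allP/(_ i)|j _].
  by rewrite mem_index_enum => /(_ isT).
by rewrite -expr2 sqr_ge0.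
Qed.

Lemma enorm_sqr u : enorm u ^+ 2 = dot u u.
Proof.
rewrite /enorm sqr_sqrtr; first by apply: eq_bigr => i _; rewrite expr2.
by apply: sumr_ge0 => i _; rewrite sqr_ge0.
Qed.

Lemma addr1_dot_gt0 u : 0 < 1 + dot u u.
Proof. by rewrite ltr_pwDl// dot_ge0. Qed.

Lemma addr1_dot_neq0 u : 1 + dot u u != 0.
Proof. by rewrite gt_eqF// addr1_dot_gt0. Qed.

End EuclideanDot.

(** * The standard coordinate frame *)

Section Frame.
Context {R : realType} {n : nat}.
Implicit Types (u v : 'cV[R]_n.+1).
Local Notation e := (@basis_vec R n).

Lemma basis_vecE i k : e i k 0 = (k == i)%:R.
Proof. by rewrite mxE eqxx andbT. Qed.

Lemma dot_basisr u i : dot u (e i) = u i 0.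
Proof.
rewrite /dot (bigD1 i)//= basis_vecE eqxx mulr1 big1 ?addr0// => j ji.
by rewrite basis_vecE (negbTE ji) mulr0.
Qed.

Lemma sum_basis u : \sum_i u i 0 *: e i = u.
Proof.
apply/colP => k; rewrite summxE (bigD1 k)//= mxE basis_vecE eqxx mulr1.
rewrite big1 ?addr0// => j jk.
by rewrite mxE basis_vecE eq_sym (negbTE jk) mulr0.
Qed.

End Frame.

(** * Calculus of directional derivatives *)

Section DirectionalDerivative.
Context {R : realType} {V : normedModType R}.
Implicit Types (x v : V).

(** The [is_derive_point] rules are phrased for explicit pointwise functions, so that a derivative
    can be assembled as one term and simplified only at the end, through [is_derive_eq]. *)
Lemma is_derive_point_cst (W : normedModType R) (c : W) x v :
  is_derive x v (fun=> c) 0.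
Proof. exact: is_derive_cst. Qed.

Lemma is_derive_point_id x v : is_derive x v (fun y => y) v.
Proof. exact: is_derive_id. Qed.

Lemma is_derive_pointD (W : normedModType R) (f g : V -> W) x v df dg :
  is_derive x v f df -> is_derive x v g dg ->
  is_derive x v (fun y => f y + g y) (df + dg).
Proof. exact: is_deriveD. Qed.

Lemma is_derive_pointN (W : normedModType R) (f : V -> W) x v df :
  is_derive x v f df -> is_derive x v (fun y => - f y) (- df).
Proof. exact: is_deriveN. Qed.

Lemma is_derive_pointM (f g : V -> R) x v df dg :
  is_derive x v f df -> is_derive x v g dg ->
  is_derive x v (fun y => f y * g y) (df * g x + f x * dg).
Proof.
move=> dfx dgx; apply: (is_derive_eq (is_deriveM dfx dgx)).
by rewrite addrC; congr (_ + _); exact: mulrC.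
Qed.

Lemma is_derive_pointV (f : V -> R) x v df : f x != 0 ->
  is_derive x v f df ->
  is_derive x v (fun y => (f y)^-1) (- df / f x ^+ 2).
Proof.
move=> fx0 [dfx <-]; apply: DeriveDef; first exact: derivableV.
by rewrite deriveV// scaleNr mulNr mulrC.
Qed.

Lemma is_derive_mxP m n (M : V -> 'M[R]_(m, n)) x v dM :
  is_derive x v M dM <->
  forall i j, is_derive x v (fun y => M y i j) (dM i j).
Proof.
split=> [[dMx <-] i j|H].
  split; last by rewrite derive_mx// mxE.
by have /derivable_mxP := dMx; apply.
have dMx : derivable M x v by apply/derivable_mxP => i j; case: (H i j).
split=> //; rewrite derive_mx//.
by apply/matrixP => i j; rewrite mxE derive_val.
Qed.

Lemma is_derive_pointZ m n (f : V -> R) (M : V -> 'M[R]_(m, n)) x v df dM :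
  is_derive x v f df -> is_derive x v M dM ->
  is_derive x v (fun y => f y *: M y) (df *: M x + f x *: dM).
Proof.
move=> dfx /is_derive_mxP dMx; apply/is_derive_mxP => i j.
rewrite !mxE (_ : (fun _ => _) = (fun y => f y * M y i j)); last first.
  by apply/funext => y; rewrite mxE.
exact: is_derive_pointM.
Qed.

Lemma is_derive_sum_point (W : normedModType R) k (f : 'I_k -> V -> W) x v df :
  (forall i, is_derive x v (f i) (df i)) ->
  is_derive x v (fun y => \sum_i f i y) (\sum_i df i).
Proof.
move=> H; have := is_derive_sum H.
by congr is_derive; apply/funext => y; rewrite fct_sumE.
Qed.

Lemma is_derive_dot n (F G : V -> 'cV[R]_n) x v dF dG :
  is_derive x v F dF -> is_derive x v G dG ->
  is_derive x v (fun y => dot (F y) (G y)) (dot dF (G x) + dot (F x) dG).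
Proof.
move=> /is_derive_mxP HF /is_derive_mxP HG; rewrite /dot -big_split/=.
by apply: is_derive_sum_point => i; exact: is_derive_pointM.
Qed.

Lemma is_derive_mulmx m n p (M : 'M[R]_(m, n)) (F : V -> 'M[R]_(n, p)) x v dF :
  is_derive x v F dF -> is_derive x v (fun y => M *m F y) (M *m dF).
Proof.
move=> /is_derive_mxP HF; apply/is_derive_mxP => i j.
rewrite mxE (_ : (fun _ => _) = (fun y => \sum_k M i k * F y k j)); last first.
  by apply/funext => y; rewrite mxE.
by apply: is_derive_sum_point.
Qed.

End DirectionalDerivative.

(** * Christoffel symbols and curvature of the spherical metric *)

Section ConformalChristoffel.
Context {R : realType}.

(* Christoffel form of the metric e^{2 s} dx^2 for p = - grad s. *)
Definition conf_conn n (p u v : 'cV[R]_n) : 'cV[R]_n :=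
  dot u v *: p - dot p u *: v - dot p v *: u.

Lemma conf_conn0r n (p u : 'cV[R]_n) : conf_conn p u 0 = 0.
Proof. by rewrite /conf_conn !dot0r !scale0r scaler0 !subrr. Qed.

Lemma is_derive_conf_conn n (V : normedModType R) (p W : V -> 'cV[R]_n) x v u
    dp dW :
  is_derive x v p dp -> is_derive x v W dW ->
  is_derive x v (fun y => conf_conn (p y) u (W y))
    (conf_conn dp u (W x) + conf_conn (p x) u dW).
Proof.
move=> Hp HW; have Hu := is_derive_point_cst u x v.
apply: (is_derive_eq (is_derive_pointD (is_derive_pointD
  (is_derive_pointZ (is_derive_dot Hu HW) Hp)
  (is_derive_pointN (is_derive_pointZ (is_derive_dot Hp Hu) HW)))
  (is_derive_pointN (is_derive_pointZ (is_derive_dot Hp HW) Hu)))).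
rewrite /conf_conn /= !dotE; apply/colP => i; rewrite !mxE; ring.
Qed.

Definition sph n (x : 'cV[R]_n) : R := 1 + dot x x.

(* Minus the gradient of the logarithm of the spherical conformal factor. *)
Definition sph_grad n (x : 'cV[R]_n) : 'cV[R]_n := (2 / sph x) *: x.

Lemma sph_neq0 n (x : 'cV[R]_n) : sph x != 0.
Proof. exact: addr1_dot_neq0. Qed.

(** The logarithmic form of the derivative keeps later formulas in terms of [sph] and [sph_grad]. *)
Lemma is_derive_sph n (x v : 'cV[R]_n) :
  is_derive x v (@sph n) (sph x * dot (sph_grad x) v).
Proof.
have Hx := is_derive_point_id x v.
apply: (is_derive_eq (is_derive_pointD (is_derive_point_cst (1 : R) x v)
  (is_derive_dot Hx Hx))).
have sx0 := sph_neq0 x.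
rewrite /sph_grad !dotE (dotC v) /=; field.
exact: sx0.
Qed.

Lemma is_derive_sph_grad n (x v : 'cV[R]_n) :
  is_derive x v (@sph_grad n)
    ((2 / sph x) *: v - dot (sph_grad x) v *: sph_grad x).
Proof.
have Hx := is_derive_point_id x v.
have sx0 := sph_neq0 x.
apply: (is_derive_eq (is_derive_pointZ (is_derive_pointM
  (is_derive_point_cst (2 : R) x v)
  (is_derive_pointV sx0 (is_derive_sph x v))) Hx)).
rewrite /sph_grad /= !dotE; apply/colP => i; rewrite !mxE; field.
exact: sx0.
Qed.

Lemma dot_sph_grad n (x : 'cV[R]_n) :
  dot (sph_grad x) (sph_grad x) = 4 * (sph x - 1) / sph x ^+ 2.
Proof.
have sx0 := sph_neq0 x.
rewrite /sph_grad !dotE (_ : sph x - 1 = dot x x); last first.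
  by rewrite /sph addrC addKr.
by field.
Qed.

Lemma spherical_metricE n (x : 'cV[R]_n) :
  spherical_metric x = (4 / sph x ^+ 2)%:M.
Proof. by rewrite /spherical_metric enorm_sqr. Qed.

Lemma inner_spherical n (x u v : 'cV[R]_n) :
  inner spherical_metric x u v = 4 / sph x ^+ 2 * dot u v.
Proof.
by rewrite /inner spherical_metricE mul_mx_scalar -scalemxAl mxE dot_mulmxE.
Qed.

Lemma invmx_spherical n (x : 'cV[R]_n) :
  invmx (spherical_metric x) = (sph x ^+ 2 / 4)%:M.
Proof. by rewrite spherical_metricE invmx_scalar invf_div. Qed.

Lemma derive_spherical n (x v : 'cV[R]_n) i j :
  'D_v (fun y => spherical_metric y i j) x
  = - (8 / sph x ^+ 2) * dot (sph_grad x) v * (i == j)%:R.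
Proof.
rewrite (_ : (fun _ => _) = (fun y => 4 * (sph y * sph y)^-1 * (i == j)%:R));
  last first.
  by apply/funext => y; rewrite spherical_metricE mxE expr2 mulr_natr.
have sx0 := sph_neq0 x.
have Hs := is_derive_pointM (is_derive_sph x v) (is_derive_sph x v).
have Hc (c : R) := is_derive_point_cst c x v.
apply: derive_val.
have HV := is_derive_pointV
  (mulf_neq0 sx0 sx0 : (fun y => sph y * sph y) x != 0) Hs.
apply: (is_derive_eq (is_derive_pointM (is_derive_pointM (Hc 4) HV) (Hc _))).
rewrite /=; field.
exact: sx0.
Qed.

Lemma christoffel_spherical n (x : 'cV[R]_n.+1) k i j :
  christoffel spherical_metric x k i j =
  sph_grad x k 0 * (i == j)%:R - sph_grad x i 0 * (j == k)%:R
  - sph_grad x j 0 * (i == k)%:R.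
Proof.
have sx0 := sph_neq0 x.
rewrite /christoffel (bigD1 k)//= big1 => [|l lk]; last first.
  by rewrite invmx_spherical mxE eq_sym (negbTE lk) mul0r.
rewrite invmx_spherical mxE eqxx mulr1n !derive_spherical !dot_basisr.
by field.
Qed.

Lemma christoffel_vec_spherical n (x u v : 'cV[R]_n.+1) :
  christoffel_vec spherical_metric x u v = conf_conn (sph_grad x) u v.
Proof.
apply/colP => k; rewrite [LHS]mxE.
transitivity (dot u v * sph_grad x k 0 - dot (sph_grad x) u * v k 0
  - dot (sph_grad x) v * u k 0); last by rewrite !mxE.
under eq_bigr => i _ do under eq_bigr => j _ do
  rewrite christoffel_spherical !mulrBl.
under eq_bigr => i _ do rewrite !sumrB.
rewrite !sumrB; congr (_ - _ - _).
- rewrite [in RHS]mulr_suml; apply: eq_bigr => i _.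
  rewrite (bigD1 i)//= eqxx mulr1 big1 ?addr0 => [|j ji]; first by ring.
  by rewrite eq_sym (negbTE ji) mulr0 !mul0r.
- rewrite mulr_suml; apply: eq_bigr => i _.
  rewrite (bigD1 k)//= eqxx mulr1 big1 ?addr0 => [|j ji]; first by ring.
  by rewrite (negbTE ji) mulr0 !mul0r.
- rewrite exchange_big mulr_suml; apply: eq_bigr => j _.
  rewrite (bigD1 k)//= eqxx mulr1 big1 ?addr0 => [|i ik]; first by ring.
  by rewrite (negbTE ik) mulr0 !mul0r.
Qed.

Lemma nabla_spherical_cst n (u v x : 'cV[R]_n.+1) :
  nabla spherical_metric (fun=> u) (fun=> v) x = conf_conn (sph_grad x) u v.
Proof. by rewrite /nabla christoffel_vec_spherical derive_cst add0r. Qed.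

(** Constant sectional curvature one: 4 / S^2 is the factor of the metric itself. *)
Lemma curvature_at_spherical n (x u v w : 'cV[R]_n.+1) :
  curvature_at spherical_metric x u v w =
  (4 / sph x ^+ 2) *: (dot v w *: u - dot u w *: v).
Proof.
have nablaE (y z : 'cV[R]_n.+1) :
    nabla spherical_metric (fun=> y) (nabla spherical_metric (fun=> z)
      (fun=> w)) x =
    conf_conn ((2 / sph x) *: y - dot (sph_grad x) y *: sph_grad x) z w
    + conf_conn (sph_grad x) y (conf_conn (sph_grad x) z w).
  rewrite (_ : nabla _ (fun=> z) _ = fun t => conf_conn (sph_grad t) z w);
    last by apply/funext => t; rewrite nabla_spherical_cst.
  rewrite /nabla christoffel_vec_spherical; congr (_ + _).
  apply: derive_val; apply: (is_derive_eq (is_derive_conf_conn z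
    (is_derive_sph_grad x y) (is_derive_point_cst w x y))).
  by rewrite conf_conn0r addr0.
(* Constant fields commute, so the bracket term is a derivative along 0. *)
rewrite /curvature_at /curvature !nablaE /nabla /lie_bracket !derive_cst.
rewrite subrr christoffel_vec_spherical add0r.
have := dot_sph_grad x; have sx0 := sph_neq0 x.
(* From here on, [sph_grad x] is an arbitrary vector whose squared length is given by [pp]. *)
move: (sph_grad x) => p pp; rewrite /conf_conn !dotE.
rewrite pp (dotC v u) (dotC u p) (dotC v p).
by apply/colP => i; rewrite !mxE; field.
Qed.

End ConformalChristoffel.

(** * Open sets and locality *)

Section OpenSets.
Context {R : realType} {n : nat}.
Implicit Types (U : set 'cV[R]_n) (x : 'cV[R]_n).

Lemma near_open U (P : 'cV[R]_n -> Prop) x :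
  open U -> U x -> (forall y, U y -> P y) -> \near x, P x.
Proof. by move=> oU Ux UP; apply: (filterS UP); exact: open_nbhs_nbhs. Qed.

Lemma open_setC1 x : open (~` [set x]).
Proof.
apply: closed_openC; apply/accessible_closed_set1/hausdorff_accessible.
exact: norm_hausdorff.
Qed.

End OpenSets.

(** * Traces in the coordinate frame *)

Section Traces.
Context {R : realType} {n : nat}.
Local Notation e := (@basis_vec R n).
Implicit Types (p u v w : 'cV[R]_n.+1).

Lemma dot_basis_basis i : dot (e i) (e i) = 1.
Proof. by rewrite dot_basisr basis_vecE eqxx. Qed.

Lemma sum_dot_basis u v : \sum_i dot u (e i) * dot v (e i) = dot u v.
Proof. by apply: eq_bigr => i _; rewrite !dot_basisr. Qed.

Lemma sum_dot_basisZ u : \sum_i dot u (e i) *: e i = u.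
Proof. by under eq_bigr do rewrite dot_basisr; exact: sum_basis. Qed.

Lemma trace_spherical m x (B : 'cV[R]_n.+1 -> 'cV[R]_n.+1 -> 'cV[R]_m.+1) :
  trace_metric spherical_metric x B =
  (sph x ^+ 2 / 4) *: \sum_i B (e i) (e i).
Proof.
rewrite /trace_metric scaler_sumr; apply: eq_bigr => i _.
rewrite invmx_spherical (bigD1 i)//= mxE eqxx mulr1n big1 ?addr0// => j ji.
by rewrite mxE eq_sym (negbTE ji) mulr0n scale0r.
Qed.

(** The first term of [conf_conn] gives [p] once for each of the [n.+1] basis vectors; the other two
    give [- p] each. *)
Lemma sum_conf_conn p :
  \sum_i conf_conn p (e i) (e i) = (n.+1%:R - 2) *: p.
Proof.
rewrite /conf_conn; under eq_bigr do rewrite dot_basis_basis scale1r.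
rewrite !sumrB sumr_const card_ord sum_dot_basisZ.
by rewrite scalerBl scaler_nat mulr2n scalerDl scale1r opprD addrA.
Qed.

End Traces.

(** * Conformal maps and the transported Levi-Civita connection *)

Section PulledBackConnection.
Context {R : realType} {n : nat}.
Implicit Types (U : set 'cV[R]_n.+1) (f : 'cV[R]_n.+1 -> 'cV[R]_n.+1).
Implicit Types (L : 'cV[R]_n.+1 -> 'M[R]_n.+1) (c d : R).
Implicit Types (q x u v : 'cV[R]_n.+1).

Definition quad c d q x : R := c * dot x x + 2 * dot q x + d.

(** The gradient of log |Q|, the analogue of [sph_grad] for the pulled-back metric. *)
Definition quad_grad c d q x : 'cV[R]_n.+1 :=
  (2 / quad c d q x) *: (c *: x + q).

(* On U, f has Jacobian L and pulls the spherical metric back to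
   4 (c d - |q|^2) / Q^2 dx^2 for the quadratic polynomial Q = quad c d q;
   the last field is the naturality of the Levi-Civita connection. *)
Record conformal_frame U f L c d q : Prop := ConformalFrame {
  frame_open : open U;
  frame_quad : forall x, U x -> quad c d q x != 0;
  frame_derive : forall x v, U x -> is_derive x v f (L x *m v);
  frame_dot : forall x u v, U x -> dot (L x *m u) (L x *m v) =
    (c * d - dot q q) * sph (f x) ^+ 2 / quad c d q x ^+ 2 * dot u v;
  frame_conn : forall x v (W : 'cV[R]_n.+1 -> 'cV[R]_n.+1) dW,
    U x -> is_derive x v W dW ->
    is_derive x v (fun y => L y *m W y)
      (L x *m (dW + conf_conn (quad_grad c d q x) v (W x))
       - conf_conn (sph_grad (f x)) (L x *m v) (L x *m W x)) }.

Lemma is_derive_quad c d q x v : quad c d q x != 0 ->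
  is_derive x v (quad c d q) (quad c d q x * dot (quad_grad c d q x) v).
Proof.
move=> Q0; have Hx := is_derive_point_id x v.
have Hc (a : R) := is_derive_point_cst a x v.
apply: (is_derive_eq (is_derive_pointD (is_derive_pointD
  (is_derive_pointM (Hc c) (is_derive_dot Hx Hx))
  (is_derive_pointM (Hc 2) (is_derive_dot (is_derive_point_cst q x v) Hx)))
  (Hc d))).
by rewrite /quad_grad !dotE (dotC v x); field.
Qed.

Lemma is_derive_quad_grad c d q x v : quad c d q x != 0 ->
  is_derive x v (quad_grad c d q)
    ((2 * c / quad c d q x) *: v
     - dot (quad_grad c d q x) v *: quad_grad c d q x).
Proof.
move=> Q0; have HQ := is_derive_quad v Q0.
have Hx := is_derive_point_id x v.
have Hc (a : R) := is_derive_point_cst a x v.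
apply: (is_derive_eq (is_derive_pointZ
  (is_derive_pointM (Hc 2) (is_derive_pointV Q0 HQ))
  (is_derive_pointD (is_derive_pointZ (Hc c) Hx)
    (is_derive_point_cst q x v)))).
by rewrite /quad_grad !dotE; apply/colP => i; rewrite !mxE; field.
Qed.

(** Rests on |c x + q|^2 = c Q - (c d - |q|^2). With [dot_sph_grad] and [dot_sph_quad_grad] it makes
    every scalar product of the two gradients rational in S and Q, so that [field] can close the
    later identities. *)
Lemma dot_quad_grad c d q x : quad c d q x != 0 ->
  dot (quad_grad c d q x) (quad_grad c d q x) =
  4 * (c * quad c d q x - (c * d - dot q q)) / quad c d q x ^+ 2.
Proof.
move=> Q0; rewrite /quad_grad !dotE (dotC x q).
have : c * quad c d q x = c * (c * dot x x + 2 * dot q x + d) by [].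
by move: (quad c d q x) Q0 => Q Q0 ->; field.
Qed.

Lemma dot_sph_quad_grad c d q x : quad c d q x != 0 ->
  dot (sph_grad x) (quad_grad c d q x) =
  2 * (quad c d q x + c * sph x - c - d) / (sph x * quad c d q x).
Proof.
move=> Q0; have S0 := sph_neq0 x; rewrite /sph_grad /quad_grad !dotE (dotC x q).
have -> : 2 * (quad c d q x + c * sph x - c - d) = 4 * (c * dot x x + dot q x).
  by rewrite /quad /sph; ring.
by field; rewrite S0 Q0.
Qed.

(** Closed forms of fields along [f] are available only on [U]; since the connection sees only
    germs, they may be substituted before differentiating. *)
Lemma nabla_pullback_near_eq f X (V W : 'cV[R]_n.+1 -> 'cV[R]_n.+1)
    (h : metric R n.+1) x :
  (\near x, V x = W x) -> nabla_pullback h f X V x = nabla_pullback h f X W x.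
Proof.
move=> VW; rewrite /nabla_pullback (near_eq_derive _ VW).
by rewrite (nbhs_singleton VW).
Qed.

Section Frame.
Variables (U : set 'cV[R]_n.+1) (f : 'cV[R]_n.+1 -> 'cV[R]_n.+1).
Variables (L : 'cV[R]_n.+1 -> 'M[R]_n.+1) (c d : R) (q : 'cV[R]_n.+1).
Hypothesis fL : conformal_frame U f L c d q.

Lemma frame_near (P : 'cV[R]_n.+1 -> Prop) x :
  U x -> (forall y, U y -> P y) -> \near x, P x.
Proof.
by move=> Ux; apply: near_open Ux; exact: (frame_open fL).
Qed.

Lemma derive_frame x v : U x -> 'D_v f x = L x *m v.
Proof. by move=> Ux; apply: derive_val; exact: (frame_derive fL). Qed.

(** The correction term in [frame_conn] is exactly the Christoffel term of the pull-back connection,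
    so the two cancel. *)
Lemma nabla_pullback_frame (X W : 'cV[R]_n.+1 -> 'cV[R]_n.+1) x dW :
  U x -> is_derive x (X x) W dW ->
  nabla_pullback spherical_metric f X (fun y => L y *m W y) x =
  L x *m (dW + conf_conn (quad_grad c d q x) (X x) (W x)).
Proof.
move=> Ux HW; have H := frame_conn fL Ux HW.
rewrite /nabla_pullback christoffel_vec_spherical derive_frame//.
by rewrite (derive_val (is_derive := H)) subrK.
Qed.

(** The image under [L x] of the difference of two Levi-Civita connections on the domain;
    [conf_conn] is linear in its first argument. *)
Lemma second_fundamental_form_frame x u v : U x ->
  second_fundamental_form spherical_metric spherical_metric f x u v =
  L x *m conf_conn (quad_grad c d q x - sph_grad x) u v.
Proof.
move=> Ux; rewrite /second_fundamental_form nabla_spherical_cst derive_frame//.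
have nearD : \near x, 'D_v f x = L x *m v.
  by apply: frame_near => // y Uy; rewrite derive_frame.
rewrite (nabla_pullback_near_eq _ _ _ nearD).
rewrite (nabla_pullback_frame Ux (is_derive_point_cst v x _)) -mulmxBr add0r.
congr (_ *m _); move: (quad_grad _ _ _ _) (sph_grad _) => a b.
by rewrite /conf_conn !dotE; apply/colP => i; rewrite !mxE; ring.
Qed.

End Frame.

End PulledBackConnection.

(** * Algebra of the trace of a second covariant derivative in dimension four *)

Section TraceAlgebra.
Context {R : realType}.
Local Notation e := (@basis_vec R 3).
Variables (a r : 'cV[R]_4) (h m s b : R).

(* With a = - grad of the log spherical factor and a + r its analogue for the
   pulled-back metric, this is the derivative of r. *)
Let dr (v : 'cV[R]_4) := b *: v - dot (a + r) v *: (a + r) + dot a v *: a.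

(** For h = S^2 / 2 and r = grad log (Q / S) this will be the covariant derivative of the field W.
    Detaching it from the base point makes its trace pure algebra. *)
Definition deform (v : 'cV[R]_4) := m *: v - (h * dot r v) *: r.

(** The derivative along [v] of [deform w], when h, m and r have derivatives 2 h (a.v), s (r.v) and
    [dr v]. *)
Definition deform_derive (v w : 'cV[R]_4) :=
  (s * dot r v) *: w
  - ((2 * h * dot a v * dot r w + h * dot (dr v) w) *: r
     + (h * dot r w) *: dr v).

Lemma deform_sum (I : finType) (F : I -> 'cV[R]_4) :
  \sum_i deform (F i) = deform (\sum_i F i).
Proof.
by rewrite /deform sumrB -scaler_sumr -scaler_suml -mulr_sumr dot_sumr.
Qed.

(** The vector [2 *: a] is the trace of the Christoffel form in dimension four. The multiples of [a]
    add up to - 2 m + 4 m - 2 m = 0, which leaves a multiple of [r]. *)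
Lemma trace_deform :
  \sum_i (deform_derive (e i) (e i) + conf_conn (a + r) (e i) (deform (e i)))
  - deform (2 *: a) =
  (s + 2 * m - 5 * h * b + h * (5 * dot r a + 3 * dot r r)) *: r.
Proof.
(* Each summand is sorted into the shapes that [sum_dot_basisZ], [sum_dot_basis] and a count of the
   indices evaluate. *)
have termE i : deform_derive (e i) (e i)
      + conf_conn (a + r) (e i) (deform (e i)) =
    (s - h * b - 2 * m + h * (dot r a + dot r r)) *: (dot r (e i) *: e i)
    - (2 * m) *: (dot a (e i) *: e i)
    + ((m - h * b) *: r + (2 * h * (dot a (e i) * dot r (e i))) *: r
       + (2 * h * (dot r (e i) * dot r (e i))) *: r)
    + m *: a.
  have := dot_basis_basis (R := R) i; move: (e i) => v vv.
  rewrite /deform_derive /conf_conn /deform /dr !dotE vv.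
  rewrite (dotC v r) (dotC a r).
  by apply/colP => k; rewrite !mxE; ring.
under eq_bigr do rewrite termE.
rewrite !big_split/= sumrN -!scaler_sumr !sum_dot_basisZ !sumr_const card_ord.
rewrite -!scaler_suml -!mulr_sumr !sum_dot_basis.
rewrite /deform !dotE (dotC a r).
by apply/colP => k; rewrite !mxE; ring.
Qed.

End TraceAlgebra.

(** * Tension and bitension of a conformal frame *)

Section Bitension.
Context {R : realType}.
Variables (U : set 'cV[R]_4) (f : 'cV[R]_4 -> 'cV[R]_4).
Variables (L : 'cV[R]_4 -> 'M[R]_4) (c d : R) (q : 'cV[R]_4).
Hypothesis fL : conformal_frame U f L c d q.
Local Notation e := (@basis_vec R 3).
Local Notation gS := (@spherical_metric R 4).
Local Notation k := (c * d - dot q q).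
Local Notation Q := (quad c d q).
Local Notation p := (quad_grad c d q).

Definition frame_diff x := p x - sph_grad x.
Local Notation r := frame_diff.

Definition frame_tension x := (sph x ^+ 2 / 2) *: r x.
Local Notation W := frame_tension.

Lemma tension_frame x : U x -> tension gS gS f x = L x *m W x.
Proof.
move=> Ux; rewrite /tension trace_spherical.
under eq_bigr do rewrite (second_fundamental_form_frame fL)//.
(* The factor S^2 / 2 is S^2 / 4, from the inverse metric, times 4 - 2, from the trace. *)
rewrite -mulmx_sumr sum_conf_conn scalemxAr scalerA; congr (_ *m (_ *: _)).
by field.
Qed.

Definition frame_deform_coef x :=
  2 * k * sph x ^+ 2 / Q x ^+ 2 - (c + d) * sph x / Q x.

Definition frame_deform v x :=
  deform (r x) (sph x ^+ 2 / 2) (frame_deform_coef x) v.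

Let b x := 2 * c / Q x - 2 / sph x.

(** [frame_deform_coef] is a polynomial in S / Q, whose logarithmic gradient is - r; hence its
    derivative along v is s (r.v). *)
Let s x := - 4 * k * sph x ^+ 2 / Q x ^+ 2 + (c + d) * sph x / Q x.

Lemma is_derive_frame_diff x v : U x ->
  is_derive x v r
    (b x *: v - dot (sph_grad x + r x) v *: (sph_grad x + r x)
     + dot (sph_grad x) v *: sph_grad x).
Proof.
move=> Ux; have Q0 := frame_quad fL Ux.
apply: (is_derive_eq (is_derive_pointD (is_derive_quad_grad v Q0)
  (is_derive_pointN (is_derive_sph_grad x v)))).
rewrite /b /frame_diff addrCA subrr addr0.
by apply/colP => i; rewrite !mxE; ring.
Qed.

Lemma is_derive_sph2 (x v : 'cV[R]_4) :
  is_derive x v (fun y => sph y ^+ 2 / 2) (sph x ^+ 2 * dot (sph_grad x) v).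
Proof.
have Hs := is_derive_sph x v.
rewrite (_ : (fun _ => _) = (fun y => sph y * sph y * 2^-1)); last first.
  by apply/funext => y; rewrite expr2.
apply: (is_derive_eq (is_derive_pointM (is_derive_pointM Hs Hs)
  (is_derive_point_cst (2^-1 : R) x v))).
by field.
Qed.

(** The derivative is split so that the Christoffel term of the pulled-back metric cancels in
    [nabla_pullback_frame]: [frame_deform] is the covariant derivative of W. *)
Lemma is_derive_frame_tension x v : U x ->
  is_derive x v W (frame_deform v x - conf_conn (p x) v (W x)).
Proof.
move=> Ux; have Q0 := frame_quad fL Ux; have S0 := sph_neq0 x.
apply: (is_derive_eq (is_derive_pointZ (is_derive_sph2 x v)
  (is_derive_frame_diff v Ux))).
have := dot_quad_grad Q0; have := dot_sph_quad_grad Q0.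
rewrite /frame_deform /frame_deform_coef /W /frame_diff /b.
rewrite (addrCA (sph_grad x)) subrr addr0 /deform.
move: (p x) (sph_grad x) => pq ps.
rewrite /conf_conn !dotE (dotC pq ps) (dotC v pq) (dotC v ps) => -> ->.
by apply/colP => i; rewrite !mxE; field; rewrite S0 Q0.
Qed.

Lemma nabla_pullback_tension x v : U x ->
  nabla_pullback gS f (fun=> v) (tension gS gS f) x = L x *m frame_deform v x.
Proof.
move=> Ux; have nearW : \near x, tension gS gS f x = L x *m W x.
  by apply: (frame_near fL) => // y Uy; rewrite tension_frame.
rewrite (nabla_pullback_near_eq _ _ _ nearW).
by rewrite (nabla_pullback_frame fL Ux (is_derive_frame_tension v Ux)) subrK.
Qed.

Lemma is_derive_frame_deform x v w : U x ->
  is_derive x v (frame_deform w)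
    (deform_derive (sph_grad x) (r x) (sph x ^+ 2 / 2) (s x) (b x) v w).
Proof.
move=> Ux; have Q0 := frame_quad fL Ux; have S0 := sph_neq0 x.
have Hs := is_derive_sph2 x v; have Hr := is_derive_frame_diff v Ux.
have Hc (t : R) := is_derive_point_cst t x v.
have Hw := is_derive_point_cst w x v.
have Hf := is_derive_pointM (is_derive_sph x v)
  (is_derive_pointV Q0 (is_derive_quad v Q0)).
have Hm : is_derive x v frame_deform_coef
    (s x * dot (r x) v).
  rewrite (_ : frame_deform_coef = (fun y =>
      2 * k * (sph y / Q y * (sph y / Q y)) + - (c + d) * (sph y / Q y)));
    last first.
    by apply/funext => y; rewrite /frame_deform_coef -expr2 expr_div_n; ring.
  apply: (is_derive_eq (is_derive_pointD
    (is_derive_pointM (Hc _) (is_derive_pointM Hf Hf))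
    (is_derive_pointM (Hc _) Hf))).
  rewrite /s /frame_diff; move: (p x) (sph_grad x) => pq ps.
  by rewrite !dotE; field.
apply: (is_derive_eq (is_derive_pointD (is_derive_pointZ Hm Hw)
  (is_derive_pointN (is_derive_pointZ
     (is_derive_pointM Hs (is_derive_dot Hr Hw)) Hr)))).
rewrite /deform_derive; move: (r x) (sph_grad x) => rr ps.
by rewrite !dotE; apply/colP => i; rewrite !mxE; field.
Qed.

(** Inserting the scalar products of the gradients turns the coefficient in [trace_deform] into 4 -
    6 k S^2 / Q^2; all other terms in c and d cancel. *)
Lemma trace_frame_deform x : U x ->
  (sph x ^+ 2 / 4) *: (\sum_i
      (deform_derive (sph_grad x) (r x) (sph x ^+ 2 / 2) (s x) (b x) (e i) (e i)
       + conf_conn (p x) (e i) (frame_deform (e i) x))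
    - frame_deform (2 *: sph_grad x) x) =
  (2 - 3 * k * sph x ^+ 2 / Q x ^+ 2) *: W x.
Proof.
move=> Ux; have Q0 := frame_quad fL Ux; have S0 := sph_neq0 x.
have pE : p x = sph_grad x + r x by rewrite /frame_diff addrCA subrr addr0.
rewrite pE /frame_deform trace_deform /W !scalerA; congr (_ *: _).
have := dot_quad_grad Q0; have := dot_sph_quad_grad Q0; have := dot_sph_grad x.
rewrite /frame_diff /frame_deform_coef /b /s.
move: (p x) (sph_grad x) => pq ps.
rewrite !dotE (dotC pq ps) => -> -> ->.
by field; rewrite S0 Q0.
Qed.

(** The curvature trace cancels the variable part of the coefficient in [trace_frame_deform], and
    only the constant survives. *)
Lemma bitension_frame x : U x -> bitension gS gS f x = - 2 *: tension gS gS f x.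
Proof.
move=> Ux; have Q0 := frame_quad fL Ux; have S0 := sph_neq0 x.
have F0 := sph_neq0 (f x).
have trace2 : trace_metric gS x
    (nabla_pullback2 gS gS f (tension gS gS f) x) =
    (2 - 3 * k * sph x ^+ 2 / Q x ^+ 2) *: (L x *m W x).
  rewrite (scalemxAr _ (L x)) trace_spherical -trace_frame_deform//.
  rewrite -scalemxAr; congr (_ *: _).
  have termE i : nabla_pullback2 gS gS f (tension gS gS f) x (e i) (e i) =
      L x *m
      (deform_derive (sph_grad x) (r x) (sph x ^+ 2 / 2) (s x) (b x) (e i) (e i)
       + conf_conn (p x) (e i) (frame_deform (e i) x))
      - L x *m frame_deform (conf_conn (sph_grad x) (e i) (e i)) x.
    rewrite /nabla_pullback2; congr (_ - _).
      rewrite (nabla_pullback_near_eq _ _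
        (W := fun y => L y *m frame_deform (e i) y)).
        have HD := is_derive_frame_deform (e i) (e i) Ux.
        by rewrite (nabla_pullback_frame (X := fun=> e i) fL Ux HD).
      by apply: (frame_near fL) => // y Uy; rewrite nabla_pullback_tension.
    (* The pull-back derivative depends on the direction field only through its value at [x], so the
       non-constant direction may be replaced by a constant one. *)
    rewrite -[RHS](nabla_pullback_tension _ Ux) /nabla_pullback.
    by rewrite !nabla_spherical_cst.
  under eq_bigr do rewrite termE.
  rewrite sumrB -!mulmx_sumr -mulmxBr; congr (_ *m (_ - _)).
  have -> : 2 *: sph_grad x = \sum_i conf_conn (sph_grad x) (e i) (e i).
    by rewrite sum_conf_conn; congr (_ *: _); ring.
  by rewrite /frame_deform deform_sum.
rewrite /bitension trace2 trace_spherical.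
(* The factor [sph (f x) ^+ 2] from [frame_dot] cancels the one in the curvature at [f x]. *)
have curvE i : curvature_at gS (f x) (tension gS gS f x) ('D_(e i) f x)
      ('D_(e i) f x) =
    (4 * k / Q x ^+ 2) *: (L x *m (W x - dot (W x) (e i) *: e i)).
  rewrite curvature_at_spherical tension_frame// (derive_frame fL)//.
  rewrite !(frame_dot fL)// dot_basis_basis mulmxBr.
  rewrite -(scalemxAr (dot (W x) (e i)) (L x) (e i)).
  move: (L x *m W x) (L x *m e i) (dot (W x) _) => t1 t2 t.
  by apply/colP => j; rewrite !mxE; field; rewrite F0 Q0.
under eq_bigr do rewrite curvE.
(* Four copies of W minus its expansion in the frame leave 3 W. *)
rewrite -scaler_sumr -mulmx_sumr sumrB sum_dot_basisZ sumr_const card_ord.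
rewrite tension_frame// mulrSr addrK raddfMn /=; move: (L x *m W x) => Y.
by apply/colP => j; rewrite !mxE; field.
Qed.

End Bitension.

(** * Smoothness of rational maps *)

Lemma near_eq_differentiable (R : numFieldType) (V W : normedModType R)
    (f g : V -> W) x :
  (\near x, f x = g x) -> differentiable f x -> differentiable g x.
Proof.
move=> fg /diff_locallyP[cdf fE].
have gE : g \o shift x = cst (g x) + 'd f x +o_ 0 id.
  apply/eqaddoP => eps eps0; have /eqaddoP/(_ eps eps0) := fE.
  have fg0 : \forall h \near 0, f (h + x) = g (h + x).
    by move/nbhs0P: fg; apply: filterS => h; rewrite addrC.
  apply: filterS2 fg0 => h fgh.
  by rewrite !fctE /= fgh (nbhs_singleton fg).
have dgE : 'd g x = 'd f x :> (V -> W) by apply: diff_unique.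
by apply/diff_locallyP; rewrite dgE.
Qed.

Section RationalSmoothness.
Context {R : realType} {m : nat}.
Implicit Types (U : set 'cV[R]_m.+1) (f g : 'cV[R]_m.+1 -> R).

(** A class of differentiable functions stable under directional derivatives, which gives all orders
    by induction. Denominators need to be nonzero only on [U]. *)
Inductive rational_on U : ('cV[R]_m.+1 -> R) -> Prop :=
| rational_cst t : rational_on U (fun=> t)
| rational_coord i : rational_on U (fun x => x i 0)
| rationalD f g : rational_on U f -> rational_on U g ->
    rational_on U (fun x => f x + g x)
| rationalM f g : rational_on U f -> rational_on U g ->
    rational_on U (fun x => f x * g x)
| rationalV f : (forall x, U x -> f x != 0) -> rational_on U f ->
    rational_on U (fun x => (f x)^-1).

Lemma rational_sum (I : Type) (s : seq I) U (F : I -> 'cV[R]_m.+1 -> R) :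
  (forall i, rational_on U (F i)) ->
  rational_on U (fun x => \sum_(i <- s) F i x).
Proof.
move=> RF; elim: s => [|i s IH].
  by under eq_fun do rewrite big_nil; exact: rational_cst.
by under eq_fun do rewrite big_cons; exact: rationalD.
Qed.

Lemma rational_sub U (b : 'cV[R]_m.+1) i :
  rational_on U (fun x => (x - b) i 0).
Proof.
under eq_fun do rewrite !mxE.
by apply: rationalD; [exact: rational_coord|exact: rational_cst].
Qed.

Lemma differentiable_rational U f x :
  rational_on U f -> U x -> differentiable f x.
Proof.
move=> + Ux; elim=> {f} [t|i|f g _ df _ dg|f g _ df _ dg|f f0 _ df].
- exact: differentiable_cst.
- exact: differentiable_coord.
- exact: differentiableD.
- exact: differentiableM.
- by apply: differentiableV => //; exact: f0.
Qed.

Lemma derive_rational U f v : rational_on U f ->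
  exists2 g, rational_on U g & forall x, U x -> is_derive x v f (g x).
Proof.
elim=> {f} [t|i|f1 f2 _ [g1 G1 D1] _ [g2 G2 D2]
           |f1 f2 R1 [g1 G1 D1] R2 [g2 G2 D2]
           |f f0 Rf [g G D]].
- exists (fun=> 0) => [|x _]; first exact: rational_cst.
  exact: is_derive_point_cst.
- exists (fun=> v i 0) => [|x _]; first exact: rational_cst.
  by have /is_derive_mxP := is_derive_point_id x v; apply.
- exists (fun x => g1 x + g2 x) => [|x Ux]; first exact: rationalD.
  exact: is_derive_pointD (D1 x Ux) (D2 x Ux).
- exists (fun x => g1 x * f2 x + f1 x * g2 x) => [|x Ux].
    by apply: rationalD; exact: rationalM.
  exact: is_derive_pointM (D1 x Ux) (D2 x Ux).
(* The quotient rule, with the opposite and the square spelled out by the constructors of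
   [rational_on]. *)
- exists (fun x => (- 1 * g x) * ((f x)^-1 * (f x)^-1)) => [|x Ux].
    apply: rationalM; first exact: (rationalM (rational_cst _ _) G).
    by apply: rationalM; exact: rationalV.
  apply: (is_derive_eq (is_derive_pointV (f0 x Ux) (D x Ux))).
  by rewrite mulN1r -invfM -expr2.
Qed.

Lemma smooth_rational n U (F : 'cV[R]_m.+1 -> 'cV[R]_n.+1) : open U ->
  (forall i, rational_on U (fun x => F x i 0)) -> smooth_on U F.
Proof.
move=> oU RF s.
(* An iterated derivative is identified with a rational field on [U] only; openness of [U] lets the
   next derivative be taken on that field. *)
have [G RG FG] : exists2 G : 'cV[R]_m.+1 -> 'cV[R]_n.+1,
    forall i, rational_on U (fun x => G x i 0) &
    forall x, U x -> foldr (fun v H => 'D_v H) F s x = G x.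
  elim: s => [|v s [G RG FG]]; first by exists F.
  have /choice[H HG] : forall i, exists h, rational_on U h /\
      forall x, U x -> is_derive x v (fun y => G y i 0) (h x).
    by move=> i; have [h Rh Dh] := derive_rational v (RG i); exists h.
  exists (fun x => \col_i H i x) => [i|x Ux] /=.
    rewrite (_ : (fun _ => _) = H i); first by have [] := HG i.
    by apply/funext => x; rewrite mxE.
  rewrite (near_eq_derive _ (near_open oU Ux FG)).
  apply: derive_val; apply/is_derive_mxP => i j.
  by rewrite ord1 mxE; have [_] := HG i; apply.
move=> x Ux.
have dG : differentiable G x.
  have -> : G = \sum_(i < n.+1) (fun y => G y i 0 *: @basis_vec R n i).
    by apply/funext => y; rewrite fct_sumE sum_basis.
  apply: differentiable_sum => i; apply: differentiableZl.
  exact: differentiable_rational (RG i) Ux.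
apply: near_eq_differentiable dG.
by apply: (near_open oU) => // y Uy; rewrite FG.
Qed.

End RationalSmoothness.

(** * Harmonicity, biharmonicity and isometry for conformal frames *)

Section FrameRigidity.
Context {R : realType}.
Variables (U : set 'cV[R]_4) (f : 'cV[R]_4 -> 'cV[R]_4).
Variables (L : 'cV[R]_4 -> 'M[R]_4) (c d : R) (q b : 'cV[R]_4).
Hypothesis fL : conformal_frame U f L c d q.
Hypothesis k0 : c * d - dot q q != 0.
Hypothesis Ub : forall x, x != b -> U x.
Local Notation gS := (@spherical_metric R 4).

(** [L x] multiplies squared lengths by a nonzero factor. *)
Lemma frame_injective x (u : 'cV[R]_4) : U x -> L x *m u = 0 -> u = 0.
Proof.
move=> Ux Lu; apply/eqP; rewrite -dot_eq0; have := frame_dot fL u u Ux.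
rewrite Lu dot0l => /esym/eqP; rewrite mulf_eq0 => /orP[|//].
rewrite mulf_eq0 invr_eq0 !expf_eq0 /= (negbTE (frame_quad fL Ux)) orbF.
by rewrite mulf_eq0 (negbTE k0) expf_eq0 (negbTE (sph_neq0 _)).
Qed.

Lemma inner_frame x u v : U x ->
  inner gS (f x) ('D_u f x) ('D_v f x) =
  4 * (c * d - dot q q) / quad c d q x ^+ 2 * dot u v.
Proof.
move=> Ux; have Q0 := frame_quad fL Ux; have F0 := sph_neq0 (f x).
rewrite inner_spherical !(derive_frame fL)// (frame_dot fL)//.
by field; rewrite F0 Q0.
Qed.

(** Vanishing tension means r = 0, a polynomial identity that forces q = 0 and c = d. Then Q = c S
    and k = c^2, so the two metrics agree. *)
Lemma tension0_isometry :
  (forall x, U x -> tension gS gS f x = 0) -> isometry_on U gS gS f.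
Proof.
move=> T0.
(* This is S (c x + q) - Q x, that is (S Q / 2) r, after its cubic terms have cancelled. *)
pose P x : 'cV[R]_4 := sph x *: q + (c - d - 2 * dot q x) *: x.
have PU x : U x -> P x = 0.
  move=> Ux; have := T0 x Ux; rewrite (tension_frame fL)// => /frame_injective.
  move=> /(_ Ux)/eqP; rewrite scaler_eq0 mulf_eq0 expf_eq0/= invr_eq0 pnatr_eq0.
  rewrite (negbTE (sph_neq0 _))/= /frame_diff => /eqP/subr0_eq/colP pE.
  apply/colP => i; have := pE i; rewrite !mxE => {}pE.
  have Q0 := frame_quad fL Ux; have S0 := sph_neq0 x.
  have : (c * x i 0 + q i 0) * sph x = x i 0 * quad c d q x.
    have -> : c * x i 0 + q i 0 = quad c d q x / 2 *
      (2 / quad c d q x * (c * x i 0 + q i 0)) by field.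
    by rewrite pE; field.
  move/eqP; rewrite -subr_eq0 => /eqP <-; rewrite /quad /sph; ring.
(* [P] is evaluated below at 0 and at a basis vector, either of which may be the point [b] possibly
   missing from [U]. *)
have P0 x : P x = 0.
  have [-> {x}|/Ub/PU//] := eqVneq x b.
  set v := @basis_vec R 3 0.
  have Pt (t : R) : t != 0 -> P (b + t *: v) = 0.
    move=> t0; apply/PU/Ub; rewrite -subr_eq0 addrAC subrr add0r scaler_eq0.
    rewrite (negbTE t0)/= -dot_eq0 dot_basis_basis oner_eq0//.
  (* P is quadratic along lines, so its third differences vanish. *)
  have -> : P b = 3 *: P (b + 1 *: v) - 3 *: P (b + 2 *: v) + P (b + 3 *: v).
    rewrite /P /sph !dotE; apply/colP => i; rewrite !mxE; ring.
  by rewrite !Pt ?pnatr_eq0// ?oner_eq0// !scaler0 subrr addr0.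
have q0 : q = 0.
  by have := P0 0; rewrite /P /sph !dot0r addr0 scale1r scaler0 addr0.
have cd : c = d.
  have := P0 (@basis_vec R 3 0); rewrite /P q0 scaler0 add0r dot0l mulr0 subr0.
  move/eqP; rewrite scaler_eq0 -[_ == 0 :> 'cV_4]dot_eq0 dot_basis_basis.
  by rewrite oner_eq0 orbF subr_eq0 => /eqP.
move=> x Ux u v; rewrite inner_frame// inner_spherical.
have := frame_quad fL Ux; have S0 := sph_neq0 x.
have -> : quad c d q x = c * sph x by rewrite /quad /sph q0 cd dot0l; ring.
rewrite mulf_eq0 negb_or => /andP[c0 _].
by rewrite q0 dot0l -cd subr0; field; rewrite c0 S0.
Qed.

(** Equality of the metrics reads k S^2 = Q^2 on [U]; differentiating it logarithmically gives grad
    log S = grad log Q, hence r = 0. *)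
Lemma isometry_tension0 :
  isometry_on U gS gS f -> forall x, U x -> tension gS gS f x = 0.
Proof.
move=> iso x Ux; pose k := c * d - dot q q.
have kE y : U y -> k * (sph y * sph y) = quad c d q y * quad c d q y.
  move=> Uy; have := iso y Uy (@basis_vec R 3 0) (@basis_vec R 3 0).
  rewrite inner_frame// inner_spherical dot_basis_basis !mulr1.
  have Q0 := frame_quad fL Uy; have S0 := sph_neq0 y => E.
  have -> : k = 4 * k / quad c d q y ^+ 2 * (quad c d q y ^+ 2 / 4) by field.
  by rewrite E; field.
have Q0 := frame_quad fL Ux; have S0 := sph_neq0 x.
suff r0 : frame_diff c d q x = 0.
  by rewrite (tension_frame fL)// /frame_tension r0 scaler0 mulmx0.
apply/eqP; rewrite -dot_eq0; apply/eqP.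
(* The second factor becomes an arbitrary direction [v], along which [kE] is differentiated. *)
move: {2}(frame_diff c d q x) => v; rewrite /frame_diff dotDl dotNl.
apply/eqP; rewrite subr_eq0; apply/eqP.
have HS := is_derive_pointM (is_derive_point_cst k x v)
  (is_derive_pointM (is_derive_sph x v) (is_derive_sph x v)).
have HQ := is_derive_pointM (is_derive_quad v Q0) (is_derive_quad v Q0).
have := near_eq_derive v (frame_near fL Ux kE).
rewrite (derive_val (is_derive := HS)) (derive_val (is_derive := HQ)).
rewrite mul0r add0r => E.
have {}E : 2 * (k * (sph x * sph x)) * dot (sph_grad x) v =
           2 * (quad c d q x * quad c d q x) * dot (quad_grad c d q x) v.
  by transitivity (k * (sph x * dot (sph_grad x) v * sph x +
    sph x * (sph x * dot (sph_grad x) v))); [ring|rewrite E; ring].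
move: E; rewrite kE// => /esym; apply: mulfI.
by rewrite !mulf_neq0 ?pnatr_eq0.
Qed.

(** By [bitension_frame], tension and bitension vanish together. *)
Lemma biharmonic_frame : smooth_on U f ->
  (biharmonic_on U gS gS f <-> isometry_on U gS gS f) /\
  (biharmonic_on U gS gS f -> harmonic_on U gS gS f).
Proof.
move=> smf.
have BH : biharmonic_on U gS gS f -> harmonic_on U gS gS f.
  move=> [_ B]; split=> // x Ux; have := B x Ux.
  rewrite (bitension_frame fL)// => /eqP; rewrite scaler_eq0 oppr_eq0.
  by rewrite pnatr_eq0 => /eqP.
split=> //; split=> [/BH[_ T0]|/isometry_tension0 T0].
  exact: tension0_isometry.
by split=> // x Ux; rewrite (bitension_frame fL)// T0// scaler0.
Qed.

End FrameRigidity.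

(** * Conformal frames of orthogonal maps, similarities and inversions *)

Section MobiusFrames.
Context {R : realType} {n : nat}.
Implicit Types (x y u v w : 'cV[R]_n.+1) (A : 'M[R]_n.+1).

Lemma dot_orthogonal A u v : orthogonal_mx A -> dot (A *m u) (A *m v) = dot u v.
Proof. by move=> hA; rewrite dot_adj mulmxA hA mul1mx. Qed.

Lemma conf_conn_orthogonal A p u v : orthogonal_mx A ->
  conf_conn (A *m p) (A *m u) (A *m v) = A *m conf_conn p u v.
Proof.
by move=> hA; rewrite /conf_conn !dot_orthogonal// !mulmxBr -!scalemxAr.
Qed.

Lemma sph_orthogonal A u : orthogonal_mx A -> sph (A *m u) = sph u.
Proof. by move=> hA; rewrite /sph dot_orthogonal. Qed.

Lemma sph_grad_orthogonal A u : orthogonal_mx A ->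
  sph_grad (A *m u) = A *m sph_grad u.
Proof. by move=> hA; rewrite /sph_grad sph_orthogonal// scalemxAr. Qed.

(** Orthogonal maps are isometries of the sphere, so they preserve Q and commute with the
    connection; this removes [A] from the computations. *)
Lemma frame_orthogonal A U f L (c d : R) (q : 'cV[R]_n.+1) : orthogonal_mx A ->
  conformal_frame U f L c d q ->
  conformal_frame U (fun x => A *m f x) (fun x => A *m L x) c d q.
Proof.
move=> hA [oU Q0 df dotL conn]; split=> // [x v Ux|x u v Ux|x v W dW Ux HW].
- by rewrite -mulmxA; apply: is_derive_mulmx; exact: df.
- by rewrite -!mulmxA dot_orthogonal// sph_orthogonal// dotL.
- rewrite (_ : (fun _ => _) = (fun y => A *m (L y *m W y))); last first.
    by apply/funext => y; rewrite mulmxA.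
  rewrite sph_grad_orthogonal// -!mulmxA conf_conn_orthogonal// -mulmxBr.
  by apply: is_derive_mulmx; exact: conn.
Qed.

(** Here Q is [sph] composed with the map; expanding it in x gives c, d and q. *)
Lemma frame_similarity (alpha : R) w : alpha != 0 ->
  conformal_frame setT (fun x => w + alpha *: x) (fun=> alpha%:M)
    (alpha ^+ 2) (1 + dot w w) (alpha *: w).
Proof.
move=> a0.
have QE x : quad (alpha ^+ 2) (1 + dot w w) (alpha *: w) x =
    sph (w + alpha *: x).
  by rewrite /quad /sph !dotE (dotC x w); ring.
split=> [||x v _|x u v _|x v W dW _ HW].
- exact: openT.
- by move=> x _; rewrite QE sph_neq0.
- apply: (is_derive_eq (is_derive_pointD (is_derive_point_cst w x v)
    (is_derive_pointZ (is_derive_point_cst alpha x v)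
      (is_derive_point_id x v)))).
  by rewrite scale0r !add0r mul_scalar_mx.
- have S0 := sph_neq0 (w + alpha *: x).
  by rewrite QE !mul_scalar_mx !dotE; field.
- have S0 := sph_neq0 (w + alpha *: x).
  rewrite !mul_scalar_mx; under eq_fun do rewrite mul_scalar_mx.
  apply: (is_derive_eq (is_derive_pointZ (is_derive_point_cst alpha x v) HW)).
  rewrite scale0r add0r /quad_grad QE /sph_grad /conf_conn !dotE.
  by apply/colP => i; rewrite !mxE; field.
Qed.

Lemma mulmx_dot (y u : 'cV[R]_n.+1) : y *m y^T *m u = dot y u *: y.
Proof.
rewrite -mulmxA [y^T *m u]mx11_scalar -dot_mulmxE.
by rewrite mul_mx_scalar.
Qed.

(** The Jacobian is alpha / |x - b|^2 times the reflection in the hyperplane orthogonal to x - b.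
    Here Q is |x - b|^2 times [sph] of the image; expanding it in x gives c, d and q. *)
Lemma frame_inversion (alpha : R) w b : alpha != 0 ->
  conformal_frame (~` [set b])
    (fun x => w + (alpha / dot (x - b) (x - b)) *: (x - b))
    (fun x => (alpha / dot (x - b) (x - b)) *:
       (1%:M - (2 / dot (x - b) (x - b)) *: ((x - b) *m (x - b)^T)))
    (1 + dot w w)
    ((1 + dot w w) * dot b b - 2 * alpha * dot w b + alpha ^+ 2)
    (alpha *: w - (1 + dot w w) *: b).
Proof.
move=> a0; set c := 1 + dot w w; set d := (X in conformal_frame _ _ _ _ X).
set q := alpha *: w - c *: b.
pose N x := dot (x - b) (x - b).
have N0 x : (~` [set b]) x -> N x != 0.
  by move=> /eqP xb; rewrite dot_eq0 subr_eq0.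
have QE x : quad c d q x = c * N x + 2 * alpha * dot w (x - b) + alpha ^+ 2.
  by rewrite /quad /d /q /N !dotE (dotC x b); ring.
have QS x : N x != 0 ->
    quad c d q x = N x * sph (w + (alpha / N x) *: (x - b)).
  rewrite QE /c /sph /N; move: (x - b) => y Nx0.
  by rewrite !dotE (dotC y w); field.
have LE x u : (alpha / N x) *: (1%:M - (2 / N x) *: ((x - b) *m (x - b)^T)) *m u
    = (alpha / N x) *: (u - (2 * dot (x - b) u / N x) *: (x - b)).
  by rewrite -scalemxAl mulmxBl mul1mx -scalemxAl mulmx_dot scalerA mulrAC.
have dY x v : is_derive x v (fun x => x - b) v.
  apply: (is_derive_eq (is_derive_pointD (is_derive_point_id x v)
    (is_derive_point_cst (- b) x v))).
  by rewrite addr0.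
have dN x v : is_derive x v N (2 * dot (x - b) v).
  apply: (is_derive_eq (is_derive_dot (dY x v) (dY x v))).
  by rewrite dotC; ring.
have dNV x v : (~` [set b]) x -> is_derive x v (fun x => alpha / N x)
    (- 2 * alpha * dot (x - b) v / N x ^+ 2).
  move=> Ux; apply: (is_derive_eq (is_derive_pointM
    (is_derive_point_cst alpha x v) (is_derive_pointV (N0 x Ux) (dN x v)))).
  by have := N0 x Ux => Nx0; field.
split=> [|x Ux|x v Ux|x u v Ux|x v W dW Ux HW].
- exact: open_setC1.
- by rewrite QS ?N0// mulf_neq0 ?N0// sph_neq0.
- rewrite -/(N x) LE.
  apply: (is_derive_eq (is_derive_pointD (is_derive_point_cst w x v)
    (is_derive_pointZ (dNV x v Ux) (dY x v)))).
  have Nx0 := N0 x Ux.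
  by apply/colP => i; rewrite !mxE; field.
- rewrite -/(N x) !LE QS ?N0//.
  have Nx0 := N0 x Ux; have S0 := sph_neq0 (w + (alpha / N x) *: (x - b)).
  have -> : c * d - dot q q = alpha ^+ 2.
    by rewrite /d /q /c !dotE (dotC b w); ring.
  have yy : dot (x - b) (x - b) = N x by [].
  move: (N x) Nx0 yy => M M0; move: (x - b) => y yy.
  rewrite !dotE yy (dotC u y).
  by field; rewrite sph_neq0 M0.
- have Nx0 := N0 x Ux; have S0 := sph_neq0 (w + (alpha / N x) *: (x - b)).
  have Q0 : quad c d q x != 0 by rewrite QS// mulf_neq0.
  (* Q and N are about to be abstracted; solving their relation for [c] preserves it for the final
     [field]. *)
  have cE : c = (quad c d q x - 2 * alpha * dot w (x - b) - alpha ^+ 2) / N x.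
    by rewrite QE; field.
  have SE : sph (w + (alpha / N x) *: (x - b)) = quad c d q x / N x.
    by rewrite QS//; field.
  have pE : quad_grad c d q x =
      (2 / quad c d q x) *: (c *: (x - b) + alpha *: w).
    by congr (_ *: _); apply/colP => i; rewrite !mxE; ring.
  rewrite -/(N x) !LE /sph_grad SE pE; under eq_fun do rewrite -/(N _) LE.
  apply: (is_derive_eq (is_derive_pointZ (dNV x v Ux)
    (is_derive_pointD HW (is_derive_pointN (is_derive_pointZ
      (is_derive_pointM (is_derive_pointM (is_derive_point_cst (2 : R) x v)
         (is_derive_dot (dY x v) HW)) (is_derive_pointV Nx0 (dN x v)))
      (dY x v)))))).
  move: (W x) => Wx.
  have yy : dot (x - b) (x - b) = N x by [].
  move: (quad c d q x) Q0 (N x) Nx0 yy cE => Q Q0 M M0.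
  move: (x - b) => y yy cE.
  rewrite /conf_conn !dotE yy (dotC v y) (dotC y w) cE.
  by apply/colP => i; rewrite !mxE; field; rewrite Q0 M0.
Qed.

End MobiusFrames.

(** * Application to the Möbius transformations *)

Section Mobius.
Context {R : realType}.
Implicit Types (a b : 'cV[R]_4) (alpha : R) (A : 'M[R]_4).

Lemma mobius_smooth a b alpha A eps : eps = 0%N \/ eps = 2%N ->
  smooth_on (mobius_domain b eps) (mobius a b alpha A eps).
Proof.
move=> heps; apply: smooth_rational => [|i].
  rewrite /mobius_domain; case: (eps == 0%N); first exact: openT.
  exact: open_setC1.
under eq_fun do rewrite !mxE.
apply: rationalD; first exact: rational_cst.
apply: rationalM; last first.
  apply: rational_sum => j; apply: rationalM; first exact: rational_cst.
  exact: rational_sub.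
case: heps => ->; first by under eq_fun do rewrite expr0; exact: rational_cst.
(* Squaring removes the root in [enorm], so the denominator is polynomial. *)
under eq_fun do rewrite enorm_sqr; apply: rationalM; first exact: rational_cst.
apply: rationalV => [x /eqP xb|]; first by rewrite dot_eq0 subr_eq0.
by apply: rational_sum => j; apply: rationalM; exact: rational_sub.
Qed.

(** Factoring [A] out on the left turns the translation into A^T (a - alpha A b) for the similarity
    and A^T a for the inversion. *)
Lemma mobius_frame a b alpha A eps : alpha != 0 -> orthogonal_mx A ->
  eps = 0%N \/ eps = 2%N -> exists L c d q,
    c * d - dot q q = alpha ^+ 2 /\
    conformal_frame (mobius_domain b eps) (mobius a b alpha A eps) L c d q.
Proof.
move=> a0 hA; have hA' : A *m A^T = 1%:M by apply/mulmx1C.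
case=> ->.
- have -> : mobius a b alpha A 0 =
      (fun x => A *m (A^T *m (a - alpha *: (A *m b)) + alpha *: x)).
    apply/funext => x; rewrite /mobius expr0 divr1 mulmxDr mulmxA hA' mul1mx.
    by rewrite mulmxBr scalerBr -scalemxAr addrA addrAC.
  (* Proving the frame first determines the four witnesses by unification; c d - |q|^2 = alpha^2 is
     then a polynomial identity. *)
  do 4 eexists; split; last first.
    exact: (frame_orthogonal hA (frame_similarity _ a0)).
  by rewrite !dotE; ring.
- have -> : mobius a b alpha A 2 = (fun x => A *m (A^T *m a +
      (alpha / dot (x - b) (x - b)) *: (x - b))).
    apply/funext => x; rewrite /mobius enorm_sqr mulmxDr mulmxA hA' mul1mx.
    by rewrite -scalemxAr.
  do 4 eexists; split; last first.
    exact: (frame_orthogonal hA (frame_inversion _ _ a0)).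
  by rewrite !dotE (dotC b); ring.
Qed.

End Mobius.

Theorem corollary5p4 (R : realType) (a b : 'cV[R]_4) (alpha : R)
    (A : 'M[R]_4) (eps : nat)
    (halpha : alpha != 0) (hA : orthogonal_mx A)
    (heps : eps = 0%N \/ eps = 2%N) :
  let phi := mobius a b alpha A eps in
  let U := mobius_domain b eps in
  let gS : metric R 4 := spherical_metric in
  (biharmonic_on U gS gS phi <-> isometry_on U gS gS phi)
  /\ (biharmonic_on U gS gS phi -> harmonic_on U gS gS phi)
  /\ ~ proper_biharmonic_on U gS gS phi.
Proof.
move=> phi U gS.
have [L [c [d [q [kE fL]]]]] := mobius_frame a b halpha hA heps.
have k0 : c * d - dot q q != 0 by rewrite kE expf_neq0.
(* Both domains contain every point other than [b], as the rigidity argument requires. *)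
have Ub x : x != b -> U x.
  by move=> /eqP xb; rewrite /U /mobius_domain; case: (eps == 0%N).
have smooth := @mobius_smooth R a b alpha A eps heps.
have [iff harm] := biharmonic_frame fL k0 Ub smooth.
by split=> //; split=> // -[/harm].
Qed.
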